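(* Let $n\ge2$ be an integer and $\alpha\in\mathbb{R}$. Let $x_1,\dots,x_n\in\mathbb{R}$ be pairwise distinct and non-zero with $1+x_jx_k>0$ for all $j,k$. Let $A := (1+x_jx_k)_{j,k=1}^n$ and $B := \mathbf{1}_{n\times n}$ (the all-ones matrix). Then \[ (\lambda A + (1-\lambda)B)^{\circ\alpha} \leq \lambda A^{\circ\alpha} + (1-\lambda)B^{\circ\alpha} \quad\text{for all } \lambda\in[0,1] \] (in the Loewner order) if and only if $\alpha\in\mathbb{Z}^{\ge0}\cup[n,\infty)$.
   Context: For a matrix $M$ with positive entries, $M^{\circ\alpha}$ denotes the entrywise power $(m_{jk}^\alpha)$. The Loewner order on real symmetric $n\times n$ matrices: $M\le N$ iff $N-M$ is positive semidefinite. *)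

(* Defs.v *)
From mathcomp Require Import all_boot all_order all_algebra.
From mathcomp Require Import all_classical all_reals all_analysis.
Set Implicit Arguments. Unset Strict Implicit. Unset Printing Implicit Defensive.
Import Order.TTheory GRing.Theory Num.Theory.
Local Open Scope ring_scope.

Definition entrywise_pow {R : realType} {n : nat} (M : 'M[R]_n) (a : R) : 'M[R]_n :=
  \matrix_(j, k) powR (M j k) a.

Definition psdmx {R : realType} {n : nat} (M : 'M[R]_n) : Prop :=
  M^T = M /\ forall v : 'cV[R]_n, 0 <= (v^T *m M *m v) 0 0.

Definition loewner_le {R : realType} {n : nat} (M N : 'M[R]_n) : Prop :=
  psdmx (N - M).

(* Main.v *)
(** With p = x_j x_k, the matrix inequality at [lam] says that every form
    g(s) = sum_jk v_j v_k (1 + s p)^alpha satisfies g(lam) <= lam g(1) + (1 - lam) g(0).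

    Sufficiency. For a natural exponent, expand binomially. For alpha >= n, g'' is
    alpha (alpha - 1) times a form of the matrices [(1 + s p)^(alpha - 2)], which are
    positive semidefinite as soon as alpha - 2 >= n - 2.

    Necessity. Comparing the slopes of g and of its chord at 0 and 1 gives g'(0) <= g'(1),
    so alpha times the matrix [(1 + p)^r - 1], r = alpha - 1, is positive semidefinite.
    For r not a natural number, t |-> det [(1 + t p)^r - 1] does not vanish on (0, 1]: by
    Rolle, a combination of N + 1 functions (1 + x_j y)^r has at most N zeros. Hence it has
    the sign it takes near t = 0, which by Taylor expansion is that of the product of the
    binomial coefficients C(r, i), 1 <= i <= N. On the first N points, with N = 2 if r < 0
    and N = floor r + 2 otherwise, this product is negative. *)
Require Import Defs.
From mathcomp Require Import all_boot all_order all_algebra.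
From mathcomp Require Import all_classical all_reals all_analysis.
From mathcomp Require Import ring lra zify polyrcf.
Import Order.TTheory GRing.Theory Num.Theory.
Import numFieldNormedType.Exports.
Local Open Scope classical_set_scope.
Local Open Scope ring_scope.

(** * Calculus on the real line *)

Lemma is_derive1_big_sum (R : realType) (n : nat) (h : 'I_n -> R -> R) (dh : 'I_n -> R)
    (x : R) :
  (forall i, is_derive x 1 (h i) (dh i)) ->
  is_derive x 1 (fun y => \sum_(i < n) h i y) (\sum_(i < n) dh i).
Proof.
move=> H; have := @is_derive_sum R R R n h x 1 dh H.
by congr is_derive; apply/funext => y; rewrite fct_sumE.
Qed.

Lemma is_derive_affine (R : realType) (a b y : R) : is_derive y 1 (fun z => b + z * a) a.
Proof.
have D : is_derive y 1 (cst b + (id * cst a)) (0 + (y *: 0 + a *: 1)).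
  exact: (is_deriveD (is_derive_cst _ _ _)
    (is_deriveM (is_derive_id _ _) (is_derive_cst _ _ _))).
by apply: (is_derive_eq D); rewrite scaler0 !add0r /GRing.scale /= mulr1.
Qed.

Lemma is_derive_powR_affine (R : realType) (a r y : R) : 0 < 1 + y * a ->
  is_derive y 1 (fun z => (1 + z * a) `^ r) (r * a * (1 + y * a) `^ (r - 1)).
Proof.
move=> ya.
have d1 := is_derive_affine R a 1 y.
have := @is_derive1_comp R (fun z => z `^ r) _ y _ _ (is_derive1_powR r ya) d1.
by move/is_derive_eq; apply; rewrite mulrAC.
Qed.

Lemma is_derive_continuous (R : realType) (f : R -> R) (x d : R) :
  is_derive x 1 f d -> {for x, continuous f}.
Proof. by case=> df _; apply/differentiable_continuous/derivable1_diffP. Qed.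

Lemma MVT_closed (R : realType) (f df : R -> R) (a b : R) : a < b ->
  (forall x : R, a <= x <= b -> is_derive x 1 f (df x)) ->
  exists2 c, a < c < b & f b - f a = df c * (b - a).
Proof.
move=> ab H.
have [|| c cab E] := @MVT R f df a b ab.
- by move=> x; rewrite in_itv /= => /andP[/ltW ? /ltW ?]; apply: H; apply/andP.
- apply: continuous_in_subspaceT => x; rewrite inE /= in_itv /= => xab.
  exact: is_derive_continuous (H x xab).
- by exists c => //; move: cab; rewrite in_itv.
Qed.

(** The mean value theorem on [0, t] and on [t, 1] writes the gap between chord and function as
    [t * (1 - t) * (df b - df a)] with a < t < b. A third use, on [df], gives its sign. *)
Lemma ge0_second_derivative_chord_le (R : realType) (f df ddf : R -> R) :
  (forall x : R, 0 <= x <= 1 -> is_derive x 1 f (df x)) ->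
  (forall x : R, 0 <= x <= 1 -> is_derive x 1 df (ddf x)) ->
  (forall x : R, 0 <= x <= 1 -> 0 <= ddf x) ->
  forall t : R, 0 <= t <= 1 -> f t <= t * f 1 + (1 - t) * f 0.
Proof.
move=> d1 d2 p t /andP[]; rewrite le_eqVlt => /predU1P[<- _|t0].
  by rewrite mul0r add0r subr0 mul1r.
rewrite le_eqVlt => /predU1P[->|t1].
  by rewrite mul1r subrr mul0r addr0.
have [|a /andP[a0 at_] Ea] := @MVT_closed R f df 0 t t0.
  by move=> x /andP[? ?]; apply: d1; lra.
have [|b /andP[bt b1] Eb] := @MVT_closed R f df t 1 t1.
  by move=> x /andP[? ?]; apply: d1; lra.
have ab : a < b by lra.
have [|c /andP[ac cb] Ec] := @MVT_closed R df ddf a b ab.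
  by move=> x /andP[? ?]; apply: d2; lra.
have c0 : 0 <= ddf c by apply: p; lra.
have Eba : 0 <= df b - df a by rewrite Ec; apply: mulr_ge0 => //; lra.
suff -> : t * f 1 + (1 - t) * f 0 = f t + t * (1 - t) * (df b - df a).
  by rewrite lerDl mulr_ge0 // mulr_ge0; lra.
have -> : f 1 = f t + df b * (1 - t) by lra.
have -> : f t = f 0 + df a * t by lra.
ring.
Qed.

(** The derivative is a two-sided limit, so it can be tested on small positive h alone; this fits a
    bound known only to the right of x. *)
Lemma derive_le_slope (R : realType) (f : R -> R) (x d m e : R) : 0 < e ->
  is_derive x 1 f d ->
  (forall h, 0 < h < e -> f (x + h) - f x <= m * h) -> d <= m.
Proof.
move=> e0 df H; rewrite leNgt; apply/negP => md.
case: df => dv vd.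
have : (fun h => h^-1 *: (f (h *: 1 + x) - f x)) @ 0^' --> d by rewrite -vd; exact: dv.
move=> /cvgrPdist_lt/(_ (d - m)); rewrite subr_gt0 => /(_ md).
move=> [/= k k0 K].
pose h := Num.min e k / 2.
have mk : 0 < Num.min e k by rewrite lt_min e0.
have h0 : 0 < h by rewrite divr_gt0.
have hm : h < Num.min e k by rewrite ltr_pdivrMr // ltr_pMr // ltr1n.
have [he hk] : h < e /\ h < k.
  by move: hm; rewrite lt_min => /andP.
have /K : ball_ [eta Num.norm] 0 k h by rewrite /= sub0r normrN gtr0_norm.
move=> /(_ (lt0r_neq0 h0)); rewrite /GRing.scale /= mulr1.
have := H h; rewrite h0 he => /(_ isT); rewrite [h + x]addrC => A.
have B : h^-1 * (f (x + h) - f x) <= m.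
  by rewrite mulrC ler_pdivrMr.
move=> C; have := le_lt_trans (ler_norm _) C; lra.
Qed.

Lemma derive_chord_le (R : realType) (f : R -> R) (d0 d1 : R) :
  is_derive (0 : R) 1 f d0 -> is_derive (1 : R) 1 f d1 ->
  (forall t : R, 0 <= t <= 1 -> f t <= t * f 1 + (1 - t) * f 0) -> d0 <= d1.
Proof.
move=> D0 D1 H.
have A : d0 <= f 1 - f 0.
  apply: (@derive_le_slope R f 0 d0 _ 1) => // h /andP[h0 h1].
  have := H h; rewrite (ltW h0) (ltW h1) => /(_ isT); rewrite add0r; nra.
apply: (le_trans A); rewrite -lerN2.
(* Reflection moves the endpoint 1 to 0, so that the one-sided estimate applies there too. *)
pose g (t : R) := f (1 + t * -1).
have Dg : is_derive (0 : R) 1 g (- d1).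
  have e1 : 1 = 1 + 0 * -1 :> R by ring.
  have D1' : is_derive (1 + 0 * -1 : R) 1 f d1 by rewrite -e1.
  have d2 := is_derive_affine R (-1) 1 0.
  have := @is_derive1_comp R f _ 0 _ _ D1' d2.
  by move/is_derive_eq; apply; rewrite mulrN1.
apply: (@derive_le_slope R g 0 (- d1) _ 1) => // h /andP[h0 h1].
have := H (1 - h); rewrite /g add0r mul0r addr0 mulrN1.
have -> : 0 <= 1 - h <= 1 by lra.
move=> /(_ isT); nra.
Qed.

(** * Positive semidefinite powers and sufficiency *)

Lemma convex_pos (R : realType) (s p : R) : 0 <= s <= 1 -> 0 < 1 + p -> 0 < 1 + s * p.
Proof.
move=> /andP[]; rewrite le_eqVlt => /predU1P[<- _ _|s0 s1 hp].
  by rewrite mul0r addr0.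
have -> : 1 + s * p = (1 - s) + s * (1 + p) by ring.
by rewrite ltr_wpDl ?subr_ge0 // mulr_gt0.
Qed.

(** The quadratic form at v of the entrywise r-th power of 1 + s u u^T. The parameter s runs from
    the all-ones matrix at 0 to A at 1. *)
Definition pow_form {R : realType} {n : nat} (v u : 'I_n -> R) (r s : R) : R :=
  \sum_j \sum_k v j * v k * (1 + s * (u j * u k)) `^ r.

(** The factor [u j * u k] from the chain rule is absorbed into the weights, so the derivative is
    again a [pow_form] and can be differentiated in turn. *)
Lemma is_derive_pow_form (R : realType) (n : nat) (w u : 'I_n -> R) (r s : R) :
  (forall j k, 0 < 1 + u j * u k) -> 0 <= s <= 1 ->
  is_derive s 1 (pow_form w u r) (r * pow_form (fun j => w j * u j) u (r - 1) s).
Proof.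
move=> up s01.
have -> : r * pow_form (fun j => w j * u j) u (r - 1) s
   = \sum_j \sum_k w j * w k * (r * (u j * u k) * (1 + s * (u j * u k)) `^ (r - 1)).
  rewrite mulr_sumr; apply: eq_bigr => j _; rewrite mulr_sumr; apply: eq_bigr => k _.
  ring.
apply: is_derive1_big_sum => j; apply: is_derive1_big_sum => k.
have := @is_deriveZ R R R _ (w j * w k) _ _ _
  (@is_derive_powR_affine R (u j * u k) r s (convex_pos _ _ _ s01 (up j k))).
by move/is_derive_eq; apply.
Qed.

Lemma sum_sqr_form (R : realType) (n : nat) (w : 'I_n -> R) :
  \sum_j \sum_k w j * w k = (\sum_j w j) ^+ 2.
Proof. by rewrite expr2 mulr_suml; apply: eq_bigr => j _; rewrite mulr_sumr. Qed.

(* Induction on n: the Moebius change u_j = (x_j - x_0) / (1 + x_j x_0) is a congruence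
   to the matrix (1 + u_j u_k)^r with u_0 = 0, and the s-derivative of the form of
   (1 + s u_j u_k)^r only involves the n - 1 other points, with exponent r - 1. *)
Lemma powR_rank2_form_ge0 (R : realType) (n : nat) (x v : 'I_n -> R) (r : R) :
  (forall j k, 0 < 1 + x j * x k) -> n%:R - 2 <= r ->
  0 <= \sum_j \sum_k v j * v k * (1 + x j * x k) `^ r.
Proof.
case: n x v => [|n] x v; first by rewrite big_ord0.
elim: n x v r => [|n IH] x v r xp nr.
  by rewrite !big_ord1 mulr_ge0 ?powR_ge0 // -expr2 sqr_ge0.
have r0 : 0 <= r.
  by apply: le_trans nr; rewrite -addn2 natrD addrK.
pose a j := 1 + x j * x ord0.
pose d := 1 + x ord0 * x ord0.
pose u j := (x j - x ord0) / a j.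
pose w j := v j * a j `^ r.
have ap j : 0 < a j by apply: xp.
have a0 j : a j != 0 by rewrite gt_eqF.
have dp : 0 < d by apply: xp.
have E j k : 1 + x j * x k = a j * a k * d^-1 * (1 + u j * u k).
  have := a0 j; have := a0 k; have : d != 0 by rewrite gt_eqF.
  rewrite /u /a /d => h1 h2 h3; field; by rewrite h1 h2 h3.
have up j k : 0 < 1 + u j * u k.
  have := xp j k; rewrite E pmulr_rgt0 // mulr_gt0 ?invr_gt0 // mulr_gt0 //.
pose g := pow_form w u r.
have -> : \sum_j \sum_k v j * v k * (1 + x j * x k) `^ r = (d^-1 `^ r) * g 1.
  rewrite /g /pow_form mulr_sumr; apply: eq_bigr => j _; rewrite mulr_sumr; apply: eq_bigr => k _.
  rewrite E mul1r powRM ?(ltW (up _ _)) //; last first.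
    by rewrite mulr_ge0 ?invr_ge0 ?(ltW dp) // mulr_ge0 // ltW.
  rewrite powRM ?invr_ge0 ?(ltW dp) //; last by rewrite mulr_ge0 // ltW.
  rewrite powRM ?(ltW (ap _)) // /w; ring.
apply: mulr_ge0; first exact: powR_ge0.
have [c /andP[c0 c1] Ec] := @MVT_closed R g _ 0 1 ltr01
  (fun s hs => is_derive_pow_form R _ w u r s up hs).
have -> : g 1 = g 0 + (g 1 - g 0) by ring.
apply: addr_ge0.
  (* At s = 0 every power is 1 and the form is a perfect square. *)
  rewrite /g /pow_form (eq_bigr (fun j => \sum_k w j * w k)); last first.
    by move=> j _; apply: eq_bigr => k _; rewrite mul0r addr0 powR1 mulr1.
  by rewrite sum_sqr_form sqr_ge0.
rewrite Ec subr0 mulr1 mulr_ge0 //.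
(* The derivative carries a factor [u j * u k], so index 0 drops out of both sums. *)
have u0 : u ord0 = 0 by rewrite /u subrr mul0r.
rewrite /pow_form big_ord_recl big1 ?add0r; last by move=> k _; rewrite u0 mulr0 !mul0r.
pose l := lift (@ord0 n.+1).
(* Scaling the points by the square root of c brings 1 + c u_j u_k to the shape of the induction
   hypothesis. *)
pose q := Num.sqrt c.
have qq : q * q = c by rewrite -expr2 sqr_sqrtr // ltW.
have H j k : 1 + q * u (l j) * (q * u (l k)) = 1 + c * (u (l j) * u (l k)).
  by rewrite -qq; ring.
have := IH (fun j => q * u (l j)) (fun j => w (l j) * u (l j)) (r - 1) _ _.
under eq_bigr => j _ do under eq_bigr => k _ do rewrite H.
have -> : \sum_(i < n.+1) \sum_k w (lift ord0 i) * u (lift ord0 i) * (w k * u k) *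
      (1 + c * (u (lift ord0 i) * u k)) `^ (r - 1) =
    \sum_(j < n.+1) \sum_(k < n.+1) w (l j) * u (l j) * (w (l k) * u (l k)) *
      (1 + c * (u (l j) * u (l k))) `^ (r - 1).
  by apply: eq_bigr => j _; rewrite big_ord_recl u0 !mulr0 mul0r add0r.
apply.
  by move=> j k; rewrite H; apply: convex_pos => //; rewrite !ltW.
by move: nr; rewrite -[n.+2%:R]natr1; lra.
Qed.

Lemma mx_formE (R : realType) (n : nat) (M : 'M[R]_n) (v : 'cV[R]_n) :
  (v^T *m M *m v) 0 0 = \sum_j \sum_k v j 0 * v k 0 * M j k.
Proof.
rewrite exchange_big mxE /=; apply: eq_bigr => k _.
by rewrite mxE mulr_suml; apply: eq_bigr => j _; rewrite mxE; ring.
Qed.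

(** The gap between the chord of [pow_form] and its value at [lam] is the quadratic form of the
    difference of the two sides, which is symmetric by construction. *)
Lemma loewner_chordP (R : realType) (n : nat) (alpha lam : R) (x : 'I_n -> R) :
  let A : 'M[R]_n := \matrix_(j, k) (1 + x j * x k) in
  let B : 'M[R]_n := const_mx 1 in
  loewner_le (entrywise_pow (lam *: A + (1 - lam) *: B) alpha)
             (lam *: entrywise_pow A alpha + (1 - lam) *: entrywise_pow B alpha)
  <-> (forall v : 'I_n -> R, pow_form v x alpha lam <=
         lam * pow_form v x alpha 1 + (1 - lam) * pow_form v x alpha 0).
Proof.
move=> A B.
set M := entrywise_pow _ _; set N := _ + _.
have ME j k : M j k = (1 + lam * (x j * x k)) `^ alpha.
  by rewrite !mxE; congr (_ `^ _); ring.
have NE j k : N j k = lam * (1 + x j * x k) `^ alpha + (1 - lam).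
  by rewrite !mxE powR1 mulr1.
have form v : lam * pow_form v x alpha 1 + (1 - lam) * pow_form v x alpha 0
      - pow_form v x alpha lam = \sum_j \sum_k v j * v k * (N - M) j k.
  rewrite /pow_form !mulr_sumr -big_split -sumrB; apply: eq_bigr => j _.
  rewrite !mulr_sumr -big_split -sumrB; apply: eq_bigr => k _.
  rewrite [(N - M) _ _]mxE [(- M) _ _]mxE ME NE mul1r mul0r addr0 powR1 /=; ring.
split=> [[_ H] v|H].
  rewrite -subr_ge0 form; have := H (\col_j v j); rewrite mx_formE.
  congr (_ <= _); apply: eq_bigr => j _; apply: eq_bigr => k _.
  by rewrite ![(\col_j0 v j0) _ _]mxE.
split; last by move=> v; rewrite mx_formE -(form (v ^~ 0)) subr_ge0.
apply/matrixP => j k; rewrite ![_^T _ _]mxE ![(N - M) _ _]mxE ![(- M) _ _]mxE !ME !NE.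
by rewrite [x k * x j]mulrC.
Qed.

(** After the binomial theorem, the coefficient of s^i is the form of a multiple of a rank-one
    matrix, hence a multiple of a square. *)
Lemma pow_form_nat (R : realType) (n m : nat) (v x : 'I_n -> R) (s : R) :
  (forall j k, 0 < 1 + x j * x k) -> 0 <= s <= 1 ->
  pow_form v x m%:R s =
  \sum_(i < m.+1) s ^+ i * ('C(m, i)%:R * (\sum_j v j * x j ^+ i) ^+ 2).
Proof.
move=> xp s01.
rewrite (eq_bigr (fun i : 'I_m.+1 => \sum_j \sum_k v j * v k *
    ((s * (x j * x k)) ^+ i *+ 'C(m, i)))); last first.
  move=> i _; rewrite -sum_sqr_form !mulr_sumr; apply: eq_bigr => j _.
  rewrite !mulr_sumr; apply: eq_bigr => k _.
  rewrite !exprMn -mulr_natr; ring.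
rewrite exchange_big; apply: eq_bigr => j _ /=.
rewrite exchange_big; apply: eq_bigr => k _ /=.
rewrite -mulr_sumr; congr (_ * _).
rewrite powR_mulrn; last by rewrite ltW // convex_pos.
by rewrite addrC exprD1n.
Qed.

Lemma pow_form_chord_nat (R : realType) (n m : nat) (v x : 'I_n -> R) (s : R) :
  (forall j k, 0 < 1 + x j * x k) -> 0 <= s <= 1 ->
  pow_form v x m%:R s <=
  s * pow_form v x m%:R 1 + (1 - s) * pow_form v x m%:R 0.
Proof.
move=> xp s01; rewrite !pow_form_nat ?lexx ?ler01 //.
rewrite !mulr_sumr -big_split /=; apply: ler_sum => i _.
set K := 'C(m, i)%:R * _; have K0 : 0 <= K by rewrite mulr_ge0 ?sqr_ge0.
move: K K0 => K K0; rewrite !mulrA -mulrDl ler_wpM2r // {K K0}.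
(* The constant term lies on its chord; for the others s^(i+1) <= s. *)
case: i => -[|i] iH; rewrite [nat_of_ord _]/=.
  by rewrite !expr0 !mulr1; lra.
rewrite expr1n mulr1 [0 ^+ _]exprS mul0r mulr0 addr0 exprS.
case/andP: s01 => s0 s1.
by rewrite ler_piMr // exprn_ile1.
Qed.

Lemma pow_form_chord (R : realType) (n : nat) (v x : 'I_n -> R) (r s : R) :
  (2 <= n)%N -> (forall j k, 0 < 1 + x j * x k) -> n%:R <= r -> 0 <= s <= 1 ->
  pow_form v x r s <= s * pow_form v x r 1 + (1 - s) * pow_form v x r 0.
Proof.
move=> n2 xp nr.
have r2 : 2 <= r by apply: le_trans nr; rewrite ler_nat.
pose w j := v j * x j.
move: s; apply: (@ge0_second_derivative_chord_le R _ (fun s => r * pow_form w x (r - 1) s)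
  (fun s => r * ((r - 1) * pow_form (fun j => w j * x j) x (r - 1 - 1) s))).
- by move=> s s01; apply: is_derive_pow_form.
- move=> s s01.
  have := @is_deriveZ R R R _ r _ _ _ (is_derive_pow_form R n w x (r - 1) s xp s01).
  by move/is_derive_eq; apply.
- move=> s s01; rewrite mulr_ge0 ?mulr_ge0 //; try lra.
  case/andP: (s01) => s0 _.
  (* As before, s is moved into the points, now to apply [powR_rank2_form_ge0] with exponent r -
     2. *)
  have qq : Num.sqrt s * Num.sqrt s = s by rewrite -expr2 sqr_sqrtr.
  have H j k : 1 + Num.sqrt s * x j * (Num.sqrt s * x k) = 1 + s * (x j * x k).
    by rewrite -{3}qq; ring.
  have := powR_rank2_form_ge0 R n (fun j => Num.sqrt s * x j) (fun j => w j * x j)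
            (r - 1 - 1) _ _.
  under eq_bigr => j _ do under eq_bigr => k _ do rewrite H.
  apply; last by lra.
  by move=> j k; rewrite H convex_pos.
Qed.

(** The sum is the derivative of the form at 1 minus that at 0; the -1 is the power evaluated at s =
    0. *)
Lemma pow_form_chord_derive (R : realType) (n : nat) (v x : 'I_n -> R) (r : R) :
  (forall j k, 0 < 1 + x j * x k) ->
  (forall s, 0 <= s <= 1 -> pow_form v x r s <=
     s * pow_form v x r 1 + (1 - s) * pow_form v x r 0) ->
  0 <= \sum_j \sum_k v j * v k *
        (r * (x j * x k) * ((1 + x j * x k) `^ (r - 1) - 1)).
Proof.
move=> xp H.
have := @derive_chord_le R _ _ _ (is_derive_pow_form R n v x r 0 xp _)
  (is_derive_pow_form R n v x r 1 xp _) H.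
rewrite !lexx !ler01 => /(_ isT isT); rewrite -subr_ge0.
congr (_ <= _).
rewrite /pow_form !mulr_sumr -sumrB; apply: eq_bigr => j _.
rewrite !mulr_sumr -sumrB; apply: eq_bigr => k _.
rewrite mul1r mul0r addr0 powR1; ring.
Qed.

(** * Nonvanishing determinants *)

Lemma det_ge0_of_form (R : realType) (n : nat) (M : 'M[R]_n) :
  (forall v : 'cV[R]_n, 0 <= (v^T *m M *m v) 0 0) -> 0 <= \det M.
Proof.
move=> H; rewrite leNgt; apply/negP => d0.
(* det (M + s) is monic in s and has no positive root. *)
pose p := char_poly (- M).
have pE s : p.[s] = \det (s%:M + M).
  rewrite -horner_evalE /p /char_poly -det_map_mx; congr (\det _).
  apply/matrixP => i j; rewrite !mxE /= horner_evalE hornerD hornerN hornerC opprK.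
  by congr (_ + _); rewrite hornerMn hornerX.
have pm : p \is monic by apply: char_poly_monic.
have lc : 0 < lead_coef p by rewrite (monicP pm).
have [b Hb] := poly_pinfty_gt_lc lc.
pose B := Num.max b 1.
have B0 : 0 <= B by rewrite le_max ler01 orbT.
have pB : 0 <= p.[B].
  by apply: le_trans (ltW lc) (Hb _ _); rewrite le_max lexx.
have p0 : p.[0] <= 0 by rewrite pE raddf0 add0r ltW.
have [|s /andP[s0 _]] := @poly_ivt R p 0 B B0; first by rewrite p0 pB.
rewrite /root pE => /det0P [v v0 vM].
have sp : 0 < s.
  rewrite lt_def s0 andbT; apply/eqP => sz.
  move: d0; have /eqP -> : \det M == 0; last by rewrite ltxx.
  by apply/det0P; exists v => //; move: vM; rewrite sz raddf0 add0r.
have := H v^T; rewrite trmxK.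
(* Thus v is an eigenvector for -s < 0, and the form of M there is -s |v|^2, which forces v = 0. *)
have -> : v *m M = - (s *: v).
  by apply/eqP; rewrite -addr_eq0 addrC -mul_mx_scalar -mulmxDr vM.
rewrite mulNmx -scalemxAl mxE [X in - X]mxE oppr_ge0 pmulr_rle0 //.
rewrite mxE; under eq_bigr => j _ do rewrite mxE -expr2.
move=> S; have /eqP : \sum_j v 0 j ^+ 2 = 0.
  by apply/eqP; rewrite eq_le S sumr_ge0 // => j _; exact: sqr_ge0.
rewrite psumr_eq0; last by move=> j _; exact: sqr_ge0.
move=> /allP K; move/negP: v0; apply; apply/eqP/rowP => j; rewrite mxE.
by have := K j (mem_index_enum _); rewrite /= sqrf_eq0 => /eqP.
Qed.

Lemma powR_sub1M (R : realType) (a r : R) : 0 < a -> a `^ r = a `^ (r - 1) * a.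
Proof.
move=> a0; rewrite -{3}[a]powRr1 ?ltW // -powRD ?subrK //.
by rewrite (gt_eqF a0) implybT.
Qed.

Lemma affine_pos_between (R : realType) (a b c x : R) : a < c < b ->
  0 < 1 + a * x -> 0 < 1 + b * x -> 0 < 1 + c * x.
Proof.
move=> /andP[ac cb] ha hb; have [x0|x0] := lerP 0 x.
  by apply: lt_le_trans ha _; rewrite lerD2l ler_wpM2r // ltW.
by apply: lt_le_trans hb _; rewrite lerD2l ler_wnM2r // ltW.
Qed.

(** Induction on n by Rolle. An exponent that is not a natural number stays so when lowered by 1,
    hence never reaches 0. Indexing the zeros by [nat] makes neighbours [z i] and [z i.+1]. *)
Lemma powR_comb_sorted_zeros (R : realType) (n : nat) (r : R) (x c : 'I_n -> R)
    (z : nat -> R) :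
  (forall k : nat, r != k%:R) -> injective x ->
  (forall i, (i.+1 < n)%N -> z i < z i.+1) ->
  (forall i j, (i < n)%N -> 0 < 1 + z i * x j) ->
  (forall i, (i < n)%N -> \sum_j c j * (1 + z i * x j) `^ r = 0) ->
  forall j, c j = 0.
Proof.
elim: n r x c z => [|n IH] r x c z rN xI zS zP zZ; first by case.
pose x0 := x ord0.
(* Dividing by the first function makes it constant, so that derivation removes it and
   lowers the exponent by 1. *)
pose psi y := \sum_j c j * ((1 + y * x j) `^ r * (1 + y * x0) `^ (- r)).
pose dpsi y := \sum_j c j *
  (r * (x j - x0) * (1 + y * x j) `^ (r - 1) * (1 + y * x0) `^ (- r - 1)).
have dP y : (forall j, 0 < 1 + y * x j) -> is_derive y 1 psi (dpsi y).
  move=> yp; apply: is_derive1_big_sum => j.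
  have D := is_deriveM (is_derive_powR_affine R (x j) r y (yp j))
                       (is_derive_powR_affine R x0 (- r) y (yp ord0)).
  have := @is_deriveZ R R R _ (c j) _ _ _ D.
  move/is_derive_eq; apply; rewrite /GRing.scale /=.
  rewrite (powR_sub1M R _ r (yp j)) (powR_sub1M R _ (- r) (yp ord0)) /x0.
  ring.
have psiZ i : (i < n.+1)%N -> psi (z i) = 0.
  move=> iN; rewrite /psi; under eq_bigr do rewrite mulrA.
  by rewrite -mulr_suml zZ // mul0r.
(* Rolle puts a zero of [dpsi] between neighbouring zeros of [psi]; 0 is a dummy value beyond the
   range. *)
have /choice [z' z'P] : forall i, exists c', (i < n)%N ->
    z i < c' < z i.+1 /\ dpsi c' = 0.
  move=> i; case: (ltnP i n) => iN; last by exists 0.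
  have zi : z i < z i.+1 by apply: zS.
  have [|c' c'P E] := @MVT_closed R psi dpsi _ _ zi.
    move=> y /andP[]; rewrite le_eqVlt => /predU1P[<- _|yl].
      by apply: dP => j; apply: zP; rewrite ltnS ltnW.
    rewrite le_eqVlt => /predU1P[->|yr].
      by apply: dP => j; apply: zP; rewrite ltnS.
    apply: dP => j; apply: (@affine_pos_between R (z i) (z i.+1)).
    - by rewrite yl.
    - by apply: zP; rewrite ltnS ltnW.
    - by apply: zP; rewrite ltnS.
  exists c' => _; split=> //.
  move/eqP: E; rewrite !psiZ ?ltnS // 1?ltnW // subrr eq_sym mulf_eq0 subr_eq0.
  by rewrite (gt_eqF zi) orbF => /eqP.
have z'pos i j : (i < n)%N -> 0 < 1 + z' i * x j.
  move=> iN; have [zb _] := z'P i iN.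
  apply: (@affine_pos_between R (z i) (z i.+1)) => //.
  - by apply: zP; rewrite ltnS ltnW.
  - by apply: zP; rewrite ltnS.
have r0 : r != 0 by rewrite (rN 0%N).
(* Up to the nonzero factors r and (1 + y x0)^(-r-1), [dpsi] is a combination of n powers with
   exponent r - 1 and coefficients c_j (x_j - x0). *)
have cl j : c (lift ord0 j) * (x (lift ord0 j) - x0) = 0.
  apply: (IH (r - 1) (x \o lift ord0) (fun j => c (lift ord0 j) * (x (lift ord0 j) - x0)) z').
  - move=> k; apply/eqP => E; have := rN k.+1.
    by rewrite -natr1 -E subrK eqxx.
  - exact: (inj_comp xI (@lift_inj _ _)).
  - move=> i iN; have [/andP[_ h1] _] := z'P i (ltnW iN).
    by have [/andP[h2 _] _] := z'P i.+1 iN; apply: lt_trans h2.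
  - by move=> i j' iN; apply: z'pos.
  - move=> i iN; have [_ E] := z'P i iN.
    have w0 : (1 + z' i * x0) `^ (- r - 1) != 0.
      by rewrite gt_eqF // powR_gt0 // z'pos.
    apply: (mulfI r0); apply: (mulIf w0); rewrite mulr0 mul0r -[RHS]E /dpsi {E}.
    rewrite big_ord_recl subrr mulr0 !mul0r mulr0 add0r mulr_sumr mulr_suml.
    by apply: eq_bigr => k _ /=; ring.
have cz j : c (lift ord0 j) = 0.
  move/eqP: (cl j); rewrite mulf_eq0 subr_eq0 => /orP[/eqP //|/eqP /xI].
  by move/eqP; rewrite eq_sym (negPf (neq_lift _ _)).
move=> j; case: (unliftP ord0 j) => [k ->|->]; first exact: cz.
have := zZ 0%N isT; rewrite big_ord_recl big1 ?addr0; last first.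
  by move=> k _; rewrite cz mul0r.
move/eqP; rewrite mulf_eq0 => /orP[/eqP //|].
by rewrite gt_eqF // powR_gt0 // zP.
Qed.

Lemma powR_comb_zeros (R : realType) (n : nat) (r : R) (x c y : 'I_n -> R) :
  (forall k : nat, r != k%:R) -> injective x -> injective y ->
  (forall k j, 0 < 1 + y k * x j) ->
  (forall k, \sum_j c j * (1 + y k * x j) `^ r = 0) ->
  forall j, c j = 0.
Proof.
move=> rN xI yI yP yZ.
(* Sorting turns distinct zeros into the increasing sequence that Rolle needs. *)
pose s := sort <=%R (codom y).
have ss : size s = n by rewrite size_sort size_codom card_ord.
have so : sorted <%R s by rewrite sort_lt_sorted; apply/injectiveP.
have nP i : (i < n)%N -> exists k, nth 0 s i = y k.
  move=> iN; have : nth 0 s i \in s by rewrite mem_nth // ss.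
  by rewrite mem_sort => /codomP.
apply: (@powR_comb_sorted_zeros R n r x c (nth 0 s)) => //.
- by move=> i iN; rewrite lt_sorted_ltn_nth // inE ss // ltnW.
- by move=> i j /nP [k ->].
- by move=> i /nP [k ->].
Qed.

Lemma det_powR_sub1_neq0 (R : realType) (n : nat) (r : R) (x y : 'I_n -> R) :
  (forall k : nat, r != k%:R) -> injective x -> injective y ->
  (forall j, x j != 0) -> (forall j, y j != 0) ->
  (forall k j, 0 < 1 + y k * x j) ->
  \det (\matrix_(j, k) ((1 + y k * x j) `^ r - 1)) != 0.
Proof.
move=> rN xI yI x0 y0 xyP; apply/negP => /det0P [v v0 vM].
(* The constant -1 is the power at the extra point x = 0, and y = 0 is an extra zero. *)
pose ext (f : 'I_n -> R) a (j : 'I_n.+1) := oapp f a (unlift ord0 j).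
have ext0 f a : ext f a ord0 = a by rewrite /ext unlift_none.
have extl f a j : ext f a (lift ord0 j) = f j by rewrite /ext liftK.
have extI f : injective f -> (forall j, f j != 0) -> injective (ext f 0).
  move=> fI f0 i j; case: (unliftP ord0 i) => [i' ->|->];
    case: (unliftP ord0 j) => [j' ->|->]; rewrite ?ext0 ?extl //.
  - by move/fI ->.
  - by move/eqP; rewrite (negPf (f0 _)).
  - by move/eqP; rewrite eq_sym (negPf (f0 _)).
(* The extra coefficient makes the combination vanish at y = 0, where all powers are 1; at [y k] its
   vanishing is the kernel equation. *)
have Z := @powR_comb_zeros R n.+1 r (ext x 0) (ext (v 0) (- \sum_j v 0 j)) (ext y 0).
move/negP: v0; apply; apply/eqP/rowP => j; rewrite mxE.
rewrite -(extl (v 0) (- \sum_j v 0 j) j); apply: Z => //; try exact: extI.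
  move=> k i; case: (unliftP ord0 i) => [i' ->|->]; rewrite ?ext0 ?extl ?mulr0 ?addr0 //.
  by case: (unliftP ord0 k) => [k' ->|->]; rewrite ?ext0 ?extl ?mul0r ?addr0.
move=> k; rewrite big_ord_recl !ext0 mulr0 addr0 powR1 mulr1.
rewrite [X in _ + X](eq_bigr (fun i => v 0 i * (1 + ext y 0 k * x i) `^ r)); last first.
  by move=> i _; rewrite !extl.
case: (unliftP ord0 k) => [k' ->|->]; rewrite ?ext0 ?extl; last first.
  rewrite [X in _ + X](eq_bigr (v 0)) ?addNr // => i _.
  by rewrite mul0r addr0 powR1 mulr1.
have /rowP/(_ k') := vM; rewrite !mxE => E.
rewrite addrC -sumrB -[RHS]E; apply: eq_bigr => i _.
by rewrite mxE mulrBr mulr1.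
Qed.

Lemma cvg_det (R : realType) (T : Type) (F : set_system T) (n : nat)
    (M : T -> 'M[R]_n) (L : 'M[R]_n) : Filter F ->
  (forall i j, M t i j @[t --> F] --> L i j) ->
  \det (M t) @[t --> F] --> \det L.
Proof.
move=> FF H; rewrite /determinant.
apply: cvg_big => [|s _]; first exact: add_continuous.
apply: cvgM; first exact: cvg_cst.
by apply: cvg_big => [|i _]; [exact: mul_continuous|exact: H].
Qed.

(** * Sign of the determinants and necessity *)

(** The generalized binomial coefficient C(r, i) for real r. *)
Definition gbin {R : realType} (r : R) (i : nat) : R :=
  (\prod_(m < i) (r - m%:R)) / i`!%:R.

(** Taylor remainder of (1 + u)^r at 0 after k terms, hence of order u^k. *)
Definition binomial_tail {R : realType} (k : nat) (r u : R) : R :=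
  (1 + u) `^ r - \sum_(i < k) gbin r i * u ^+ i.

Lemma gbin0 (R : realType) (r : R) : gbin r 0 = 1.
Proof. by rewrite /gbin big_ord0 fact0 divr1. Qed.

Lemma gbinS (R : realType) (r : R) (i : nat) :
  gbin r i.+1 * i.+1%:R = r * gbin (r - 1) i.
Proof.
rewrite /gbin big_ord_recl subr0 factS natrM.
rewrite (eq_bigr (fun m : 'I_i => r - 1 - m%:R)); last first.
  by move=> m _; rewrite /= /bump /= add1n -natr1; ring.
have : (i`!%:R : R) != 0 by rewrite pnatr_eq0 -lt0n fact_gt0.
have : (i.+1%:R : R) != 0 by rewrite pnatr_eq0.
by move: (i.+1%:R : R) (i`!%:R : R) => a b h1 h2; field; rewrite h1 h2.
Qed.

Lemma powR_bounded_near1 (R : realType) (r : R) :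
  exists2 C : R, 0 <= C & forall u, `|u| <= 2^-1 -> (1 + u) `^ r <= C.
Proof.
(* Here 1 + u lies between 1/2 and 2; one summand serves r >= 0, the other r < 0. *)
exists (2 `^ r + 2 `^ (- r)); first by rewrite addr_ge0 ?powR_ge0.
move=> u; rewrite ler_norml => /andP[u1 u2].
have up : 2^-1 <= 1 + u by lra.
have u0 : 0 < 1 + u by lra.
have [r0|r0] := lerP 0 r.
  apply: (@le_trans _ _ (2 `^ r)); last by rewrite lerDl powR_ge0.
  by apply: ge0_ler_powR => //; rewrite ?nnegrE; lra.
apply: (@le_trans _ _ (2 `^ (- r))); last by rewrite lerDr powR_ge0.
have -> : (1 + u) `^ r = ((1 + u)^-1) `^ (- r).
  by rewrite -[in RHS]powR_inv1 ?ltW // -powRrM mulN1r opprK.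
apply: ge0_ler_powR; rewrite ?nnegrE ?invr_ge0 ?oppr_ge0 ?(ltW r0) ?(ltW u0) //.
by rewrite invf_ple // posrE.
Qed.

(** By (i+1) C(r, i+1) = r C(r-1, i), differentiation gives a tail with one term fewer and exponent
    r - 1. *)
Lemma is_derive_binomial_tail (R : realType) (k : nat) (r u s : R) : 0 < 1 + s * u ->
  is_derive s 1 (fun s => binomial_tail k.+1 r (s * u))
    (r * u * binomial_tail k (r - 1) (s * u)).
Proof.
move=> su; rewrite /binomial_tail.
have D i : is_derive s 1 (fun s => gbin r i * (s * u) ^+ i)
    (gbin r i * (i%:R * (s * u) ^+ i.-1 * u)).
  have := is_deriveX i (is_derive_affine R u 0 s).
  have -> : (fun z : R => 0 + z * u) ^+ i = (fun s => (s * u) ^+ i).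
    by apply/funext => z; rewrite exprfctE add0r.
  move=> /(@is_deriveZ R R R _ (gbin r i)).
  by move/is_derive_eq; apply; rewrite add0r /GRing.scale.
have Ds := is_derive1_big_sum R k.+1 _ _ s (fun i : 'I_k.+1 => D i).
have := is_deriveB (is_derive_powR_affine R u r s su) Ds.
move/is_derive_eq; apply; rewrite big_ord_recl mul0r mul0r mulr0 add0r.
rewrite mulrBr; congr (_ - _).
rewrite mulr_sumr; apply: eq_bigr => i _ /=.
rewrite /bump /= add1n mulrA mulrA gbinS; ring.
Qed.

(** Induction on k: the tail vanishes at 0, and the mean value theorem along s u, 0 <= s <= 1, gains
    one factor u. *)
Lemma binomial_tail_bound (R : realType) (k : nat) (r : R) :
  exists2 C : R, 0 <= C & forall u, `|u| <= 2^-1 ->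
    `|binomial_tail k r u| <= C * `|u| ^+ k.
Proof.
elim: k r => [|k IH] r.
  have [C C0 H] := powR_bounded_near1 R r; exists C => // u hu.
  by rewrite /binomial_tail big_ord0 subr0 expr0 mulr1 ger0_norm ?powR_ge0 ?H.
have [C C0 H] := IH (r - 1); exists (`|r| * C); first by rewrite mulr_ge0.
move=> u hu.
have pos s : 0 <= s <= 1 -> 0 < 1 + s * u.
  move=> s01; apply: convex_pos => //.
  by move: hu; rewrite ler_norml => /andP[? ?]; lra.
have [c /andP[c0 c1] E] := @MVT_closed R _ _ 0 1 ltr01
  (fun s hs => is_derive_binomial_tail R k r u s (pos s hs)).
have t0 : binomial_tail k.+1 r (0 * u) = 0.
  rewrite /binomial_tail mul0r addr0 powR1 big_ord_recl gbin0 expr0 mulr1 big1 ?addr0 ?subrr //.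
  by move=> i _; rewrite /= exprS mul0r mulr0.
move: E; rewrite t0 mul1r !subr0 mulr1 => ->.
have cu : `|c * u| <= `|u|.
  by rewrite normrM gtr0_norm // ler_piMl // ltW.
rewrite !normrM exprS -!mulrA ler_wpM2l // mulrCA ler_wpM2l //.
apply: le_trans (H _ (le_trans cu hu)) _.
by rewrite ler_wpM2l // lerXn2r ?nnegrE.
Qed.

(** The tail is O(t^(n+1)) and i + 1 <= n, so at least one factor t survives the division. *)
Lemma binomial_tail_cvg0 (R : realType) (n i : nat) (r p : R) : (i < n)%N ->
  (t ^+ i.+1)^-1 * binomial_tail n.+1 r (t * p) @[t --> 0^'+] --> (0 : R).
Proof.
move=> iN.
have [C C0 H] := binomial_tail_bound R n.+1 r.
pose K := C * `|p| ^+ n.+1.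
have K0 : 0 <= K by rewrite mulr_ge0 ?exprn_ge0.
apply/cvgr0Pnorm_lt => e e0.
near=> t.
have t0 : 0 < t by near: t; exact: nbhs_right_gt.
have t1 : t <= 1 by apply: ltW; near: t; exact: nbhs_right_lt.
have tp : `|t * p| <= 2^-1.
  rewrite normrM gtr0_norm //.
  have : t < 2^-1 / (`|p| + 1)
    by near: t; apply: nbhs_right_lt; rewrite divr_gt0 ?invr_gt0 // ltr_wpDl.
  rewrite ltr_pdivlMr ?ltr_wpDl // => /ltW; apply: le_trans.
  by rewrite ler_wpM2l ?ltW // ltrDl.
have te : t * K < e.
  have : t < e / (K + 1)
    by near: t; apply: nbhs_right_lt; rewrite divr_gt0 // ltr_wpDl.
  rewrite ltr_pdivlMr ?ltr_wpDl //; apply: le_lt_trans.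
  by rewrite ler_wpM2l ?ltW // ltrDl.
apply: le_lt_trans te.
have ti0 : 0 < t ^+ i.+1 by rewrite exprn_gt0.
rewrite normrM [X in X * _]gtr0_norm ?invr_gt0 // mulrC ler_pdivrMr //.
apply: le_trans (H _ tp) _.
rewrite normrM exprMn [`|t|]gtr0_norm // mulrCA -/K [leRHS]mulrAC ler_wpM2r //.
by rewrite -exprS ler_wiXn2l // ltW.
Unshelve. all: by end_near.
Qed.

(** Factoring x_j out of row j leaves a transposed Vandermonde matrix. *)
Lemma det_power_mx_neq0 (R : realType) (n : nat) (x : 'I_n -> R) :
  injective x -> (forall j, x j != 0) -> \det (\matrix_(j < n, i < n) x j ^+ i.+1) != 0.
Proof.
move=> xI x0.
have -> : \matrix_(j < n, i < n) x j ^+ i.+1 =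
    diag_mx (\row_j x j) *m (Vandermonde n (\row_j x j))^T.
  apply/matrixP => j i; rewrite mul_diag_mx !mxE exprS; by [].
rewrite det_mulmx det_tr det_diag det_Vandermonde mulf_neq0 //.
  by apply/prodf_neq0 => j _; rewrite mxE.
apply/prodf_neq0 => i _; apply/prodf_neq0 => j ij; rewrite !mxE subr_eq0.
by apply: contraTneq ij => /xI ->; rewrite ltnn.
Qed.

Lemma det_powR_sub1_lt0_near0 (R : realType) (n : nat) (r : R) (x : 'I_n -> R) :
  injective x -> (forall j, x j != 0) -> \prod_(i < n) gbin r i.+1 < 0 ->
  \forall t \near 0^'+,
    \det (\matrix_(j, k) ((1 + t * (x j * x k)) `^ r - 1) : 'M[R]_n) < 0.
Proof.
move=> xI x0 neg.
pose X : 'M[R]_n := \matrix_(j, i) x j ^+ i.+1.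
have Xu : X \in unitmx by rewrite unitmxE unitfE det_power_mx_neq0.
pose Y := invmx X.
pose D (t : R) : 'M[R]_n := \matrix_(j, k) ((1 + t * (x j * x k)) `^ r - 1).
pose E (t : R) : 'M[R]_n := \matrix_(j, k) binomial_tail n.+1 r (t * (x j * x k)).
pose c : 'rV[R]_n := \row_i gbin r i.+1.
pose T (t : R) : 'rV[R]_n := \row_i (t ^+ i.+1)^-1.
(* For t > 0, M t is D t up to congruence by X and to a positive row scaling that makes
   it converge to the diagonal of binomial coefficients. *)
pose M (t : R) : 'M[R]_n := diag_mx c + diag_mx (T t) *m Y *m E t *m Y^T.
(* The constant Taylor term cancels the -1; terms 1 to n give the congruence by X, and the rest is
   [E t]. *)
have DE t : D t = X *m diag_mx (\row_i (gbin r i.+1 * t ^+ i.+1)) *m X^T + E t.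
  apply/matrixP => j k; rewrite mul_mx_diag !mxE /binomial_tail big_ord_recl.
  rewrite gbin0 expr0 mulr1.
  rewrite [X in _ = X + _](_ : _ = \sum_(i < n)
      gbin r (lift ord0 i) * (t * (x j * x k)) ^+ lift ord0 i); first ring.
  by apply: eq_bigr => i _; rewrite !mxE /= /bump /= add1n !exprMn; ring.
have MD t : 0 < t -> M t = diag_mx (T t) *m Y *m D t *m Y^T.
  move=> t0; rewrite DE mulmxDr mulmxDl; congr (_ + _).
  rewrite -!mulmxA -trmx_mul mulVmx // trmx1 mulmx1 (mulmxA Y) mulVmx // mul1mx.
  apply/matrixP => i l; rewrite mul_diag_mx !mxE.
  case: eqP => [->|_]; last by rewrite !mulr0n mulr0.
  by rewrite !mulr1n mulrCA mulVf ?mulr1 // gt_eqF // exprn_gt0.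
have Mc : \det (M t) @[t --> 0^'+] --> \det (diag_mx c).
  apply: cvg_det => i l.
  rewrite (_ : (fun t => M t i l) = (fun t => diag_mx c i l +
     \sum_k \sum_j (t ^+ i.+1)^-1 * binomial_tail n.+1 r (t * (x j * x k))
        * (Y i j * Y l k))); last first.
    apply/funext => t; rewrite mxE; congr (_ + _).
    rewrite -!mulmxA mul_diag_mx mxE [T t 0 i]mxE mulmxA mxE mulr_sumr.
    apply: eq_bigr => k _; rewrite mxE mulr_suml mulr_sumr; apply: eq_bigr => j _.
    rewrite ![E t _ _]mxE ![Y^T _ _]mxE; ring.
  rewrite -[X in _ --> X]addr0; apply: cvgD; first exact: cvg_cst.
  rewrite [X in _ --> X](_ : _ = \sum_(k < n) \sum_(j < n) 0 * (Y i j * Y l k)); last first.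
    by rewrite big1 // => k _; rewrite big1 // => j _; rewrite mul0r.
  apply: cvg_big => [|k _]; first exact: add_continuous.
  apply: cvg_big => [|j _]; first exact: add_continuous.
  by apply: cvgM; [exact: binomial_tail_cvg0|exact: cvg_cst].
have dc : \det (diag_mx c) < 0.
  by rewrite det_diag; under eq_bigr => i _ do rewrite mxE.
near=> t.
have t0 : 0 < t by near: t; exact: nbhs_right_gt.
have h : \det (M t) < 0 by near: t; exact: (cvgr_lt _ Mc _ dc).
have h1 : 0 < \prod_i T t 0 i.
  by apply: prodr_gt0 => i _; rewrite mxE invr_gt0 exprn_gt0.
(* det (M t) is det (D t) times a positive product and a square. *)
rewrite -/(D t) ltNge; apply/negP => d0; move: h; rewrite ltNge => /negP; apply.
rewrite MD // !det_mulmx det_tr det_diag.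
set p := \prod_i _ in h1 *; have -> : p * \det Y * \det (D t) * \det Y =
  p * \det (D t) * \det Y ^+ 2 by ring.
by rewrite mulr_ge0 ?sqr_ge0 // mulr_ge0 // ltW.
Unshelve. all: by end_near.
Qed.

(** The determinant is negative for small t, continuous, and nonzero on (0, 1] by
    [det_powR_sub1_neq0] at the points t x_k; the intermediate value theorem carries the sign to t =
    1. *)
Lemma det_powR_sub1_lt0 (R : realType) (n : nat) (r : R) (x : 'I_n -> R) :
  (forall k : nat, r != k%:R) -> injective x -> (forall j, x j != 0) ->
  (forall j k, 0 < 1 + x j * x k) -> \prod_(i < n) gbin r i.+1 < 0 ->
  \det (\matrix_(j, k) ((1 + x j * x k) `^ r - 1) : 'M[R]_n) < 0.
Proof.
move=> rN xI x0 xp neg.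
pose D (t : R) : 'M[R]_n := \matrix_(j, k) ((1 + t * (x j * x k)) `^ r - 1).
have pos t j k : 0 <= t <= 1 -> 0 < 1 + t * (x j * x k).
  by move=> t01; apply: convex_pos.
have D0 t : 0 < t <= 1 -> \det (D t) != 0.
  move=> /andP[t0 t1].
  have := @det_powR_sub1_neq0 R n r x (fun k => t * x k) rN xI.
  have -> : \matrix_(j, k) ((1 + t * x k * x j) `^ r - 1) = D t.
    by apply/matrixP => j k; rewrite !mxE mulrAC mulrA.
  apply => //.
  - by move=> j k /(mulfI (lt0r_neq0 t0)) /xI.
  - by move=> j; rewrite mulf_neq0 // lt0r_neq0.
  - by move=> k j; rewrite -mulrA pos // (ltW t0).
have -> : \matrix_(j, k) ((1 + x j * x k) `^ r - 1) = D 1.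
  by apply/matrixP => j k; rewrite !mxE mul1r.
have [t [t0 t1 dt]] : exists t, [/\ 0 < t, t < 1 & \det (D t) < 0].
  near (0 : R)^'+ => t; exists t; split; near: t.
  - exact: nbhs_right_gt.
  - exact: nbhs_right_lt.
  - exact: det_powR_sub1_lt0_near0.
rewrite ltNge; apply/negP => d1.
have cD : {within `[t, 1], continuous (fun s => \det (D s))}.
  apply: continuous_in_subspaceT => s; rewrite inE /= in_itv /= => /andP[ts s1].
  apply: cvg_det => j k.
  rewrite (_ : (fun s => D s j k) = (fun s => (1 + s * (x j * x k)) `^ r - 1)); last first.
    by apply/funext => z; rewrite mxE.
  rewrite mxE; apply: cvgB; last exact: cvg_cst.
  apply: (is_derive_continuous R _ s _ (is_derive_powR_affine R (x j * x k) r s _)).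
  by apply: pos; rewrite s1 (le_trans (ltW t0)).
have [|s] := @IVT R _ t 1 0 (ltW t1) cD.
  by rewrite ge_min le_max (ltW dt) d1 orbT.
rewrite in_itv /= => /andP[ts s1] /eqP; apply/negP.
by apply: D0; rewrite s1 (lt_le_trans t0).
Unshelve. all: by end_near.
Qed.

(** C(r, 1) = r is negative and C(r, 2) = r (r - 1) / 2 is positive. *)
Lemma prod_gbin_lt0_neg (R : realType) (r : R) : r < 0 ->
  \prod_(i < 2) gbin r i.+1 < 0.
Proof.
move=> r0; rewrite !big_ord_recl big_ord0 /= /bump /= mulr1.
rewrite /gbin !big_ord_recl !big_ord0 /bump /= !subr0 !mulr1 divr1.
rewrite nmulr_rlt0 // divr_gt0 //.
by rewrite nmulr_rgt0 // subr_lt0 (lt_trans r0).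
Qed.

(** C(r, i) is positive for i <= m + 1, while C(r, m + 2) has exactly one negative factor, r - (m +
    1). *)
Lemma prod_gbin_lt0 (R : realType) (r : R) (m : nat) : m%:R < r < m.+1%:R ->
  \prod_(i < m.+2) gbin r i.+1 < 0.
Proof.
move=> /andP[mr rm]; rewrite big_ord_recr /= pmulr_rlt0.
  rewrite /gbin pmulr_llt0 ?invr_gt0 ?ltr0n ?fact_gt0 //.
  rewrite big_ord_recr /= pmulr_rlt0 ?subr_lt0 //.
  apply: prodr_gt0 => i _; rewrite subr_gt0; apply: le_lt_trans mr.
  by rewrite ler_nat -ltnS.
apply: prodr_gt0 => i _; rewrite /gbin divr_gt0 ?ltr0n ?fact_gt0 //.
apply: prodr_gt0 => j _; rewrite subr_gt0; apply: le_lt_trans mr.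
by rewrite ler_nat; have := ltn_ord j; have := ltn_ord i; lia.
Qed.

(** The map e selects a submatrix of a positive semidefinite matrix. Pulling x out of its rows and
    columns changes the determinant by a nonzero square, and alpha contributes [alpha ^+ N]. *)
Lemma det_chord_form_ge0 (R : realType) (n N : nat) (alpha : R) (x : 'I_n -> R)
    (e : 'I_N -> 'I_n) :
  (forall j, x j != 0) ->
  (forall v : 'I_n -> R, 0 <= \sum_j \sum_k v j * v k *
        (alpha * (x j * x k) * ((1 + x j * x k) `^ (alpha - 1) - 1))) ->
  0 <= alpha ^+ N *
    \det (\matrix_(j, k) ((1 + x (e j) * x (e k)) `^ (alpha - 1) - 1) : 'M[R]_N).
Proof.
move=> x0 H; set D := \matrix_(j, k) _.
pose M : 'M[R]_n := \matrix_(j, k)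
  (alpha * (x j * x k) * ((1 + x j * x k) `^ (alpha - 1) - 1)).
pose P : 'M[R]_(N, n) := rowsub e 1%:M.
pose d : 'rV[R]_N := \row_j x (e j).
pose S : 'M[R]_N := diag_mx d *m (alpha *: D) *m diag_mx d.
have SE : S = P *m M *m P^T.
  have -> : P *m M *m P^T = mxsub e e M.
    rewrite -rowsubE -[LHS]trmxK trmx_mul trmxK -rowsubE.
    by apply/matrixP => j k; rewrite !mxE.
  apply/matrixP => j k; rewrite /S mul_mx_diag mul_diag_mx !mxE; ring.
have S0 : 0 <= \det S.
  apply: det_ge0_of_form => v.
  have := H (fun j => (P^T *m v) j 0).
  rewrite (_ : \sum_j _ = ((P^T *m v)^T *m M *m (P^T *m v)) 0 0); last first.
    rewrite mx_formE; apply: eq_bigr => j _; apply: eq_bigr => k _.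
    by rewrite [M _ _]mxE.
  by rewrite trmx_mul trmxK SE !mulmxA.
move: S0; rewrite /S !det_mulmx detZ det_diag.
set p := \prod_i _.
have p0 : p != 0 by apply/prodf_neq0 => i _; rewrite mxE.
have -> : p * (alpha ^+ N * \det D) * p = p ^+ 2 * (alpha ^+ N * \det D) by ring.
by rewrite pmulr_rge0 // exprn_even_gt0.
Qed.

Theorem mainTheorem12 (R : realType) (n : nat) (alpha : R) (x : 'I_n -> R) :
  (2 <= n)%N ->
  injective x ->
  (forall j, x j != 0) ->
  (forall j k, 0 < 1 + x j * x k) ->
  let A : 'M[R]_n := \matrix_(j, k) (1 + x j * x k) in
  let B : 'M[R]_n := const_mx 1 in
  (forall lam : R, 0 <= lam <= 1 ->
     loewner_le (entrywise_pow (lam *: A + (1 - lam) *: B) alpha)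
                (lam *: entrywise_pow A alpha + (1 - lam) *: entrywise_pow B alpha))
  <-> ((exists m : nat, alpha = m%:R) \/ n%:R <= alpha).
Proof.
move=> n2 xI x0 xp A B; split; last first.
  move=> H lam lam01; apply/loewner_chordP => v.
  case: H => [[m ->]|na]; first exact: pow_form_chord_nat.
  exact: pow_form_chord.
move=> H; have [|aN] := pselect (exists m : nat, alpha = m%:R); first by left.
right; rewrite leNgt; apply/negP => an.
have psd v : 0 <= \sum_j \sum_k v j * v k *
    (alpha * (x j * x k) * ((1 + x j * x k) `^ (alpha - 1) - 1)).
  apply: pow_form_chord_derive => // s s01.
  by have /loewner_chordP := H s s01; apply.
have rN (k : nat) : alpha - 1 != k%:R.
  apply/eqP => E; apply: aN; exists k.+1.
  by rewrite -natr1 -E subrK.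
have contra N : (N <= n)%N -> 0 < alpha ^+ N ->
    \prod_(i < N) gbin (alpha - 1) i.+1 < 0 -> False.
  move=> Nn aN0 neg.
  have := @det_chord_form_ge0 R n N alpha x (widen_ord Nn) x0 psd.
  apply/negP; rewrite -ltNge pmulr_rlt0 //.
  apply: (@det_powR_sub1_lt0 R N _ (fun j => x (widen_ord Nn j))) => // i j /xI E.
  by apply/val_inj; have := congr1 val E.
(* For alpha < 1, N = 2 works: alpha is nonzero, so its square is positive. *)
have [a1|a1] := ltrP alpha 1.
  apply: (contra 2%N) => //; last by apply: prod_gbin_lt0_neg; lra.
  rewrite exprn_even_gt0 //=; apply/eqP => a0; apply: aN.
  by exists 0%N.
have r0 : 0 <= alpha - 1 by lra.
have /andP[mr rm] := truncn_itv r0.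
(* With m = floor (alpha - 1), m + 1 <= alpha < n gives m + 2 <= n, so enough points are
   available. *)
set m := Num.trunc _ in mr rm.
apply: (contra m.+2).
- have : (m.+1%:R : R) < n%:R by rewrite -natr1; lra.
  by rewrite ltr_nat.
- by rewrite exprn_gt0 // (lt_le_trans ltr01).
- by apply: prod_gbin_lt0; rewrite rm andbT lt_def mr andbT rN.
Qed.
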